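(* Let $S$ be a numerical semigroup with multiplicity $m$ and Kunz coordinates $(k_1,\dots,k_{m-1})$. The ideals $E$ of $S$ with $\min(E)=0$ are in one-to-one correspondence, via $E\mapsto (k_1(E),\dots,k_{m-1}(E))$, with the set $\mathcal{K}(S)$ of solutions $(x_1,\dots,x_{m-1})$ in non-negative integers of the system of inequalities $$x_i\le k_i \quad\text{for all } i\in\{1,\dots,m-1\},$$ $$x_{i+j}-x_i\le k_j \quad\text{for all } i,j\in\{1,\dots,m-1\} \text{ with } i+j<m,$$ $$x_{i+j-m}-x_i\le k_j+1 \quad\text{for all } i,j\in\{1,\dots,m-1\} \text{ with } i+j>m.$$
   Context: $\mathbb{N}$ denotes the non-negative integers. A numerical semigroup $S$ is a submonoid of $(\mathbb{N},+)$ with finite complement in $\mathbb{N}$. The multiplicity $m$ of $S$ is its smallest positive element. An ideal of $S$ is a non-empty set $E\subseteq\mathbb{Z}$ with $S+E\subseteq E$ and such that $s+E\subseteq S$ for some $s\in S$. For an ideal $E$ with $\min(E)=0$ (in particular for $E=S$) and $i\in\{0,\dots,m-1\}$, $w_i(E)$ denotes the least element of $E$ congruent to $i$ modulo $m$, and $k_i(E)\in\mathbb{N}$ is defined by $w_i(E)=k_i(E)m+i$. The Kunz coordinates of $E$ are $(k_1(E),\dots,k_{m-1}(E))$. The Kunz coordinates of $S$ are those of $S$ viewed as an ideal of itself, i.e. $k_i=k_i(S)$. *)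

(* Defs.v *)
From HB Require Import structures.
From mathcomp Require Import all_boot all_order all_algebra.
From mathcomp Require Import boolp classical_sets functions cardinality.

Set Implicit Arguments.
Unset Strict Implicit.
Unset Printing Implicit Defensive.

Import Order.TTheory GRing.Theory Num.Theory.

Local Open Scope classical_set_scope.
Local Open Scope ring_scope.

Definition least (d : Order.disp_t) (T : porderType d) (A : set T) : set T :=
  A `&` lbound A.

Definition numerical_semigroup (S : set nat) : Prop :=
  [/\ S 0%N,
      forall s t : nat, S s -> S t -> S (s + t)%N &
      finite_set (~` S)].

Definition is_multiplicity (S : set nat) (m : nat) : Prop :=
  least [set s | S s /\ (0 < s)%N] m.

Definition semigroup_ideal (S : set nat) (E : set int) : Prop :=
  [/\ E !=set0,
      forall (s : nat) (e : int), S s -> E e -> E (s%:Z + e) &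
      exists2 s : nat, S s & forall e : int, E e -> (Posz @` S) (s%:Z + e)].

(* The default value 0 of [xget] in [kunz_w] and [kunz_k] is irrelevant for the
   ideals with minimum 0, for which both sets below are singletons. *)
Definition kunz_w (m : nat) (E : set int) (i : nat) : int :=
  xget 0 (least [set x | E x /\ (x = i %[mod m])%Z]).

Definition kunz_k (m : nat) (E : set int) (i : nat) : nat :=
  xget 0%N [set k : nat | kunz_w m E i = (k * m + i)%N%:Z].

(* Tuples are indexed from 0, so x_i is stored at position i - 1. *)
Definition kcoord (n : nat) (x : n.-tuple nat) (i : nat) : nat := nth 0%N x i.-1.

Definition kunz_coords (m : nat) (E : set int) : (m.-1).-tuple nat :=
  [tuple kunz_k m E i.+1 | i < m.-1].

(* The differences are taken in int: subtraction on nat is truncated. *)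
Definition kunz_solutions (m : nat) (k : (m.-1).-tuple nat) :
    set ((m.-1).-tuple nat) :=
  [set x | [/\
    forall i : nat, (0 < i < m)%N -> (kcoord x i <= kcoord k i)%N,
    forall i j : nat, (0 < i < m)%N -> (0 < j < m)%N -> (i + j < m)%N ->
      (kcoord x (i + j))%:Z - (kcoord x i)%:Z <= (kcoord k j)%:Z &
    forall i j : nat, (0 < i < m)%N -> (0 < j < m)%N -> (m < i + j)%N ->
      (kcoord x (i + j - m))%:Z - (kcoord x i)%:Z <= (kcoord k j)%:Z + 1]].

(* Main.v *)
(** For an ideal [E] with minimum 0 and [i < m], one has [n * m + i \in E] iff
    [k_i(E) <= n], and this property determines [k_i(E)].  So [E] is determined
    by its Kunz coordinates (with [k_0(E) = 0]), and conversely any coordinates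
    define by this rule a set of integers, for which [S + E `<=` E] unfolds to
    the system of inequalities, the two kinds of differences corresponding to
    the absence or presence of a carry in the addition of residues. *)
Require Import Defs.
From HB Require Import structures.
From mathcomp Require Import all_boot all_order all_algebra.
From mathcomp Require Import boolp classical_sets functions cardinality.
From mathcomp Require Import zify ring.

Set Implicit Arguments.
Unset Strict Implicit.
Unset Printing Implicit Defensive.

Import Order.TTheory GRing.Theory Num.Theory.

Local Open Scope classical_set_scope.
Local Open Scope ring_scope.

Lemma int_residueP (m : nat) (e : int) : (0 < m)%N ->
  exists q : int, exists2 i : nat, (i < m)%N & e = q * m%:Z + i%:Z.
Proof.
move=> m0; exists (e %/ m%:Z)%Z; exists `|(e %% m%:Z)%Z|%N.
  by have := ltz_pmod e (_ : 0 < m%:Z); have := @modz_ge0 e m%:Z; lia.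
by rewrite gez0_abs ?modz_ge0 -?divz_eq //; lia.
Qed.

Lemma ler_residue (m i : nat) (p q : int) : (i < m)%N ->
  (p * m%:Z + i%:Z <= q * m%:Z + i%:Z) = (p <= q).
Proof. by move=> im; rewrite lerD2r ler_pM2r //; lia. Qed.

Lemma residue_ge0 (m i : nat) (q : int) : (i < m)%N ->
  (0 <= q * m%:Z + i%:Z) = (0 <= q).
Proof.
move=> im; rewrite -(@divz_ge0 _ m%:Z); last by lia.
by rewrite divzMDl ?divz_small ?addr0 //; lia.
Qed.

(** The hypothesis makes [k * m + i] the least element of [E] in its class, which pins down both
    [xget] choices. [E] need not be known to be an ideal, so this also applies to [kunz_set x] for
    an arbitrary tuple [x]. *)
Lemma kunz_kE (m i k : nat) (E : set int) : (i < m)%N ->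
  (forall n : int, E (n * m%:Z + i%:Z) <-> k%:Z <= n) -> kunz_k m E i = k.
Proof.
move=> im Ek.
have wE : kunz_w m E i = k%:Z * m%:Z + i%:Z.
  have least_k : least [set x | E x /\ (x = i %[mod m])%Z] (k%:Z * m%:Z + i%:Z).
    split; first by split; [exact/Ek | exact: modzMDl].
    move=> e [Ee ei]; move: Ee; rewrite (divz_eq e m) ei modz_small ?ler_residue //.
    by move/Ek.
  apply: xget_unique => // e [Pe le].
  by apply/le_anti/andP; split; [exact: le least_k.1 | exact: least_k.2 Pe].
apply: xget_unique => [|k' /=]; rewrite wE.
  by rewrite /= PoszD PoszM.
by rewrite -PoszM -PoszD => -[/addIn/eqP]; rewrite eqn_pmul2r => [/eqP|]; lia.
Qed.

Lemma cofinite_nat_ge (S : set nat) :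
  finite_set (~` S) -> exists c : nat, forall n : nat, (c <= n)%N -> S n.
Proof.
move=> /finite_seqP[s Ss]; exists (\max_(n <- s) n).+1 => n cn.
apply: contrapT => nS; have /= ns : [set` s] n by rewrite -Ss.
by have := @leq_bigmax_seq _ s xpredT id n ns isT; lia.
Qed.

Lemma numerical_semigroup_ideal (S : set nat) : numerical_semigroup S ->
  semigroup_ideal S (Posz @` S) /\ least (Posz @` S) 0.
Proof.
move=> [S0 SD _]; split; last by split=> [|_ [n _ <-]]; first exists 0%N.
split; first by exists 0, 0%N.
  by move=> s _ Ss [t St <-]; exists (s + t)%N; [exact: SD | rewrite PoszD].
by exists 0%N => // e; rewrite add0r.
Qed.

Section Ideal.

Variables (S : set nat) (m : nat).
Hypotheses (hS : numerical_semigroup S) (hm : is_multiplicity S m).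

Let m_gt0 : (0 < m)%N. Proof. by case: hm => -[]. Qed.

(** Each residue class meets [E] because [S] is cofinite and [0] is in [E]; quotients are
    non-negative because [0] is the minimum; and the class is closed upwards because [m] is in
    [S]. *)
Lemma ideal_kunzP (E : set int) (i : nat) (n : int) :
  semigroup_ideal S E -> least E 0 -> (i < m)%N ->
  E (n * m%:Z + i%:Z) <-> (kunz_k m E i)%:Z <= n.
Proof.
move=> [_ SE _] [E0 Ege0] im.
have [_ _ /cofinite_nat_ge[c Sc]] := hS.
have [[Sm _] _] := hm.
have exE : exists n : nat, `[< E (n%:Z * m%:Z + i%:Z) >].
  (* Since [m] is positive, [c * m + i] is at least [c], hence in [S]; adding it to [0] in [E] stays
     in [E]. *)
  exists c; apply/asboolP; rewrite -PoszM -PoszD -[Posz _]addr0.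
  by apply: SE => //; apply: Sc; nia.
have Ek (p : int) : E (p * m%:Z + i%:Z) <-> (ex_minn exE)%:Z <= p.
  case: ex_minnP => k /asboolP Ek kmin; split.
    move=> Ep; have := Ege0 _ Ep; rewrite residue_ge0 // => p_ge0.
    have /kmin : `[< E (`|p|%N%:Z * m%:Z + i%:Z) >] by rewrite gez0_abs //; exact/asboolP.
    by lia.
  (* From [k * m + i], the element with quotient [p] is reached by adding [m] exactly [p - k]
     times. *)
  move=> kp; have -> : p = k%:Z + `|p - k%:Z|%N%:Z by lia.
  elim: `|_|%N => [|d IHd]; first by rewrite addr0.
  have -> : (k%:Z + d.+1%:Z) * m%:Z + i%:Z = m%:Z + ((k%:Z + d%:Z) * m%:Z + i%:Z).
    by rewrite -[d.+1]addn1 PoszD; ring.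
  exact: SE.
by rewrite (kunz_kE im Ek).
Qed.

(** The tuple of coordinates omits the residue 0; this supplies the missing value. *)
Lemma ideal_kunz0 (E : set int) :
  semigroup_ideal S E -> least E 0 -> kunz_k m E 0 = 0%N.
Proof.
move=> idE E0; have := ideal_kunzP 0 idE E0 m_gt0.
by rewrite mul0r add0r => -[/(_ E0.1)]; lia.
Qed.

Lemma ideal_kunz_inj (E F : set int) :
  semigroup_ideal S E -> least E 0 -> semigroup_ideal S F -> least F 0 ->
  (forall i, (0 < i < m)%N -> kunz_k m E i = kunz_k m F i) -> E = F.
Proof.
move=> idE E0 idF F0 EF; apply/funext => e; apply/propext.
have [q [i im ->]] := int_residueP e m_gt0.
apply: iff_trans (ideal_kunzP q idE E0 im) _; apply: iff_sym.
apply: iff_trans (ideal_kunzP q idF F0 im) _.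
case: (posnP i) => [->|i0]; first by rewrite !ideal_kunz0.
by rewrite EF ?i0.
Qed.

Lemma semigroup_kunzP (i n : nat) : (i < m)%N ->
  S (n * m + i)%N <-> (kunz_k m (Posz @` S) i <= n)%N.
Proof.
move=> im; have [idS S0] := numerical_semigroup_ideal hS.
have := ideal_kunzP n idS S0 im; rewrite -PoszM -PoszD lez_nat => SP.
apply: iff_trans SP; split=> [Sn|[t St [<-]] //].
by exists (n * m + i)%N.
Qed.

End Ideal.

Lemma kcoord_kunz_coords (m i : nat) (E : set int) : (0 < i < m)%N ->
  kcoord (kunz_coords m E) i = kunz_k m E i.
Proof.
move=> im; have im' : (i.-1 < m.-1)%N by lia.
rewrite /kcoord -[i.-1]/(nat_of_ord (Ordinal im')) nth_mktuple /=.
by congr kunz_k; lia.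
Qed.

(** Each inequality compares an element of [E] with the least one in its class: the first uses
    $w_i(S) + 0$, the other two use $w_j(S) + w_i(E)$, whose quotient gains 1 when $i + j > m$. *)
Lemma kunz_coords_solution (S : set nat) (m : nat) (E : set int) :
  numerical_semigroup S -> is_multiplicity S m ->
  semigroup_ideal S E -> least E 0 ->
  kunz_solutions (kunz_coords m (Posz @` S)) (kunz_coords m E).
Proof.
move=> hS hm idE E0; have [_ SE _] := idE.
pose kS i := kunz_k m (Posz @` S) i; pose kE i := kunz_k m E i.
have Smem i : (i < m)%N -> S (kS i * m + i)%N.
  by move=> im; apply/(semigroup_kunzP hS hm).
have Emem i : (i < m)%N -> E ((kE i)%:Z * m%:Z + i%:Z).
  by move=> im; apply/(ideal_kunzP hS hm).
have kE_le i (n : int) : (i < m)%N -> E (n * m%:Z + i%:Z) -> (kE i)%:Z <= n.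
  by move=> im /(ideal_kunzP hS hm _ idE E0 im).
split=> [i im|i j im jm ijm|i j im jm ijm].
- rewrite !kcoord_kunz_coords // -lez_nat; apply: kE_le; first by lia.
  by rewrite -PoszM -PoszD -[Posz _]addr0; apply: SE E0.1; apply: Smem; lia.
- rewrite !kcoord_kunz_coords; [|lia..].
  rewrite lerBlDr; apply: kE_le => //.
  have := SE _ _ (Smem j ltac:(lia)) (Emem i ltac:(lia)).
  by congr E; rewrite !PoszD PoszM /kS /kE; ring.
- rewrite !kcoord_kunz_coords; [|lia..].
  rewrite lerBlDr; apply: kE_le; first by lia.
  have := SE _ _ (Smem j ltac:(lia)) (Emem i ltac:(lia)).
  congr E; rewrite -subzn; last by lia.
  by rewrite !PoszD PoszM /kS /kE; ring.
Qed.

(** The residue 0 is set apart because [kcoord x 0] would read $x_1$, as [0.-1] is [0]. *)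
Definition kunz_ext (n : nat) (x : n.-tuple nat) (i : nat) : nat :=
  if i is 0%N then 0%N else kcoord x i.

Definition kunz_set (m : nat) (x : (m.-1).-tuple nat) : set int :=
  [set e | (kunz_ext x `|(e %% m%:Z)%Z|%N)%:Z <= (e %/ m%:Z)%Z].

Lemma kunz_setE (m i : nat) (x : (m.-1).-tuple nat) (n : int) : (i < m)%N ->
  kunz_set x (n * m%:Z + i%:Z) <-> (kunz_ext x i)%:Z <= n.
Proof.
move=> im; rewrite /kunz_set /= modzMDl modz_small; last by lia.
by rewrite divzMDl ?divz_small ?addr0 //; lia.
Qed.

Lemma kunz_coords_kunz_set (m : nat) (x : (m.-1).-tuple nat) :
  kunz_coords m (kunz_set x) = x.
Proof.
apply: eq_from_tnth => i; rewrite tnth_mktuple (tnth_nth 0%N).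
have im : (i.+1 < m)%N by have := ltn_ord i; lia.
by apply: kunz_kE => // n; apply: kunz_setE.
Qed.

(** The inequalities are first extended to the residue 0; closure under [S] then follows by adding
    quotients and residues, with or without a carry. *)
Lemma kunz_set_ideal (S : set nat) (m : nat) (x : (m.-1).-tuple nat) :
  numerical_semigroup S -> is_multiplicity S m ->
  kunz_solutions (kunz_coords m (Posz @` S)) x ->
  semigroup_ideal S (kunz_set x) /\ least (kunz_set x) 0.
Proof.
move=> hS hm [x1 x2 x3].
have m_gt0 : (0 < m)%N by case: hm => -[].
pose kS i := kunz_k m (Posz @` S) i; pose X i := kunz_ext x i.
have X0 : X 0%N = 0%N by [].
have Xpos i : (0 < i)%N -> X i = kcoord x i by case: i.
have XkS i : (i < m)%N -> (X i <= kS i)%N.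
  case: (posnP i) => [->|i0 im]; first by rewrite X0.
  by rewrite Xpos // /kS -kcoord_kunz_coords ?x1 ?i0.
have Xadd i j : (i + j < m)%N -> (X (i + j) <= X i + kS j)%N.
  (* For [i = 0] the sum inequality is the upper bound $x_j \le k_j$. *)
  case: (posnP i) => [->|i0]; first by rewrite X0; exact: XkS.
  case: (posnP j) => [->|j0 ijm]; first by rewrite addn0 leq_addr.
  have := x2 i j ltac:(lia) ltac:(lia) ijm.
  rewrite kcoord_kunz_coords; last by lia.
  by rewrite !Xpos /kS; lia.
have Xcarry i j : (i < m)%N -> (j < m)%N -> (m <= i + j)%N ->
    (X (i + j - m) <= X i + kS j + 1)%N.
  (* The system says nothing for [i + j = m], but there the resulting residue is 0, where [X]
     vanishes. *)
  move=> im jm; rewrite leq_eqVlt => /predU1P[<-|ijm]; first by rewrite subnn X0.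
  have := x3 i j ltac:(lia) ltac:(lia) ijm.
  rewrite kcoord_kunz_coords; last by lia.
  by rewrite !Xpos /kS; lia.
have E0 : kunz_set x 0.
  by have := kunz_setE x 0 m_gt0; rewrite mul0r add0r => ->.
have Ege0 e : kunz_set x e -> 0 <= e.
  have [q [i im ->]] := int_residueP e m_gt0.
  by rewrite residue_ge0 // => /(kunz_setE _ _ im); lia.
split; last by [].
split; first by exists 0.
- move=> s e Ss; have [q [i im ->]] := int_residueP e m_gt0.
  move/(kunz_setE _ _ im); rewrite -/(X i) => Xi.
  have jm := ltn_pmod s m_gt0.
  move: Ss; rewrite (divn_eq s m).
  move: (s %% m)%N (s %/ m)%N jm => j a jm /(semigroup_kunzP hS hm _ jm) kj.
  rewrite -/(kS j) in kj.
  case: (ltnP (i + j) m) => [ijm|mij].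
    have -> : (a * m + j)%N%:Z + (q * m%:Z + i%:Z) =
        (a%:Z + q) * m%:Z + (i + j)%N%:Z by rewrite !PoszD PoszM; ring.
    by apply/kunz_setE => //; have := Xadd i j ijm; rewrite -/(X _); lia.
  have -> : (a * m + j)%N%:Z + (q * m%:Z + i%:Z) =
      (a%:Z + q + 1) * m%:Z + (i + j - m)%N%:Z.
    by rewrite -subzn // !PoszD PoszM; ring.
  apply/kunz_setE; first by lia.
  by have := Xcarry i j im jm mij; rewrite -/(X _); lia.
(* Elements of [kunz_set x] are non-negative, so a shift by [c] moves them all into the range
   contained in [S]. *)
- have [_ _ /cofinite_nat_ge[c Sc]] := hS.
  exists c => [|e /Ege0 e0]; first exact: Sc.
  by exists (c + `|e|)%N; [apply: Sc; lia | lia].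
Qed.

Theorem theorem4p4 (S : set nat) (m : nat) (k : (m.-1).-tuple nat)
  (hS : numerical_semigroup S) (hm : is_multiplicity S m)
  (hk : k = kunz_coords m (Posz @` S)) :
  set_bij [set E : set int | semigroup_ideal S E /\ least E 0]
          (kunz_solutions k)
          (kunz_coords m).
Proof.
rewrite {}hk; split.
- by move=> E [idE E0]; exact: kunz_coords_solution.
- move=> E F /set_mem[idE E0] /set_mem[idF F0] EF.
  apply: (ideal_kunz_inj hS hm) => // i im.
  by rewrite -!kcoord_kunz_coords // EF.
- move=> x hx; exists (kunz_set x); last exact: kunz_coords_kunz_set.
  exact: kunz_set_ideal hx.
Qed.
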